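(* Let $n,m\in\mathbb{N}$ and let $A_k\in\mathbb{R}^{n\times n}$, $B_k\in\mathbb{R}^{n\times m}$, $Q_k\in\mathbb{S}^n_+$, $R_k\in\mathbb{S}^m_{++}$ ($k\in\mathbb{N}_0$) be problem data such that: $\|A_k\|_2,\|B_k\|_2,\|Q_k\|_2,\|R_k\|_2$ are bounded uniformly in $k$; every $A_k$ is non-singular; there is $d\in\mathbb{N}$ such that for all $k\in\mathbb{N}_0$ the $d$-step controllability matrix $\mathcal{C}_{k,d}$ has full row rank and the $d$-step observability matrix $\mathcal{O}_{k,d}$ has full column rank; and, for the lifted data $(\tilde A_t,\tilde B_t,\tilde Q_t,\tilde R_t)_{t\in\mathbb{N}_0}$ constructed with this $d$, $\inf_{t}\lambda_{\min}(\tilde Q_t)>0$, $\inf_{t}\lambda_{\min}(\tilde B_t\tilde B_t')>0$, and $\inf_{t}\lambda_{\min}(\tilde A_t\tilde A_t')>0$. Given $T\in\mathbb{N}$, let $(X_{t+T})_{t\in\mathbb{N}_0}\subset\mathbb{S}^n_{++}$ be any bounded sequence such that $$X_{t+T}\succeq\mathcal{R}_{t+T}(X_{t+T+1})\quad\text{for all } t\in\mathbb{N}_0,$$ where $\mathcal{R}_t$ is the Riccati operator of the lifted data. Then the origin is exponentially stable for the lifted dynamics $\tilde x_{t+1}=\tilde A_t\tilde x_t+\tilde B_t\tilde u_t$, $t\in\mathbb{N}_0$, under the $T$-step receding-horizon state-feedback policy $\tilde u_t=\mu^{RH}_0(t,\tilde x_t)$ with terminal penalty matrices $(X_{t+T}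)_{t\in\mathbb{N}_0}$.
   Context: Notation: $\mathbb{N}_0=\mathbb{N}\cup\{0\}$; $M'$ is the transpose; $|\cdot|$ is the Euclidean norm, $\|\cdot\|_2$ the induced (spectral) norm; $\mathbb{S}^n,\mathbb{S}^n_+,\mathbb{S}^n_{++}$ are the real symmetric, positive semi-definite, positive definite $n\times n$ matrices; $\preceq,\succeq$ is the Loewner order; $\lambda_{\min}$ is the smallest eigenvalue. Controllability and observability matrices: $\Theta_{k,d}:=A_{k+d-1}A_{k+d-2}\cdots A_k$, $\Theta_{k,0}:=I_n$, $C_k:=Q_k^{1/2}$, $\mathcal{C}_{k,d}:=[\,\Theta_{k+1,d-1}B_k\;\;\Theta_{k+2,d-2}B_{k+1}\;\cdots\;\Theta_{k+d,0}B_{k+d-1}\,]$, and $\mathcal{O}_{k,d}$ is the vertical stack of $C_k\Theta_{k,0},\,C_{k+1}\Theta_{k,1},\dots,C_{k+d}\Theta_{k,d}$. Lifted data: for $t\in\mathbb{N}_0$, $\hat A_t:=I_{n(d+1)}-\begin{bmatrix}0_{n,nd}&0_{n,n}\\ \mathrm{diag}(A_{dt},\dots,A_{d(t+1)-1})&0_{nd,n}\end{bmatrix}$, $\hat B_t:=\begin{bmatrix}0_{n,md}\\ \mathrm{diag}(B_{dt},\dots,B_{d(t+1)-1})\end{bmatrix}$, $\hat C_t:=[\,\mathrm{diag}(C_{dt},\dots,C_{d(t+1)-1})\;\;0_{nd,n}\,]$ (block-diagonal matrices); $\Phi_t:=[0_{n,nd}\;I_n]\hat A_t^{-1}\begin{bmatrix}I_n\\0_{nd,n}\end{bmatrix}$,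 $\Gamma_t:=[0_{n,nd}\;I_n]\hat A_t^{-1}\hat B_t$, $\Xi_t:=\hat C_t\hat A_t^{-1}\begin{bmatrix}I_n\\0_{nd,n}\end{bmatrix}$, $\Delta_t:=\hat C_t\hat A_t^{-1}\hat B_t$; $\tilde R_t:=\mathrm{diag}(R_{dt},\dots,R_{dt+d-1})+\Delta_t'\Delta_t$, $\tilde Q_t:=\Xi_t'\Xi_t-\Xi_t'\Delta_t\tilde R_t^{-1}\Delta_t'\Xi_t$, $\tilde A_t:=\Phi_t-\Gamma_t\tilde R_t^{-1}\Delta_t'\Xi_t$, $\tilde B_t:=\Gamma_t$. Riccati operator: $\mathcal{R}_t(P):=\tilde Q_t+\tilde A_t'\big(P-P\tilde B_t(\tilde R_t+\tilde B_t'P\tilde B_t)^{-1}\tilde B_t'P\big)\tilde A_t$ for $P\in\mathbb{S}^n_+$. Receding-horizon policy: for $t\in\mathbb{N}_0$, $\chi\in\mathbb{R}^n$, $w=(w_t,\dots,w_{t+T-1})\in((\mathbb{R}^m)^d)^T$, $X\in\mathbb{S}^n_{++}$, let $z_t=\chi$, $z_{j+1}=\tilde A_jz_j+\tilde B_jw_j$ for $t\le j\le t+T-1$, and $L_T(t,\chi,w,X):=\sum_{j=t}^{t+T-1}(z_j'\tilde Q_jz_j+w_j'\tilde R_jw_j)+z_{t+T}'Xz_{t+T}$. The policy is defined by $(\mu^{RH}_0(t,\tilde x_t),\dots,\mu^{RH}_{T-1}(t,\tilde x_t))=\arg\min_{w}L_T(t,\tilde x_t,w,X_{t+T})$, and only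 the first element $\mu_0^{RH}$ is applied. Exponential stability of the origin (standard meaning): there exist $c>0$ and $\gamma\in(0,1)$ such that $|\tilde x_t|\le c\,\gamma^{t-t_0}|\tilde x_{t_0}|$ for all $t\ge t_0\ge0$ and all $\tilde x_{t_0}\in\mathbb{R}^n$, along the closed-loop dynamics. *)

(* Defs.v *)
From mathcomp Require Import all_boot all_order all_algebra.
From mathcomp Require Import boolp classical_sets reals.

Set Implicit Arguments.
Unset Strict Implicit.
Unset Printing Implicit Defensive.

Import Order.TTheory GRing.Theory Num.Theory.
Local Open Scope classical_set_scope.
Local Open Scope ring_scope.

Definition qform (R : realType) n (M : 'M[R]_n) (x : 'cV[R]_n) : R :=
  (x^T *m M *m x) 0 0.

Definition psdmx (R : realType) n (M : 'M[R]_n) : Prop :=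
  M^T = M /\ forall x : 'cV[R]_n, 0 <= qform M x.

Definition pdmx (R : realType) n (M : 'M[R]_n) : Prop :=
  M^T = M /\ forall x : 'cV[R]_n, x != 0 -> 0 < qform M x.

Definition loewner_le (R : realType) n (M N : 'M[R]_n) : Prop := psdmx (N - M).

Definition sqrt_psdmx (R : realType) n (M : 'M[R]_n) : 'M[R]_n :=
  xget 0 [set S | psdmx S /\ S *m S = M].

Definition enorm (R : realType) n (x : 'cV[R]_n) : R :=
  Num.sqrt (\sum_i x i 0 ^+ 2).

Definition specnorm (R : realType) m n (M : 'M[R]_(m, n)) : R :=
  sup [set enorm (M *m x) | x in [set x : 'cV[R]_n | enorm x <= 1]].

(* Meant for symmetric M of positive size, whose set of real eigenvalues is
   finite and nonempty, so that the infimum is attained. *)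
Definition lambda_min (R : realType) n (M : 'M[R]_n) : R :=
  inf [set a | eigenvalue M a].

Definition unif_bounded (R : realType) m n (M : nat -> 'M[R]_(m, n)) : Prop :=
  exists c : R, forall k, specnorm (M k) <= c.

(* The blocks need not be square, unlike those of [\mxdiag]. *)
Definition blockdiag (R : realType) d p q (F : nat -> 'M[R]_(p, q)) :
    'M[R]_(\sum_(i < d) p, \sum_(j < d) q) :=
  \mxblock_(i < d, j < d) (if i == j then F i else 0).

(* A_(k+d-1) ... A_(k+1) A_k *)
Fixpoint transition (R : realType) n (A : nat -> 'M[R]_n) (k d : nat) : 'M[R]_n :=
  if d is d'.+1 then A (k + d')%N *m transition A k d' else 1%:M.

Definition ctrlmx (R : realType) n m (A : nat -> 'M[R]_n)
    (B : nat -> 'M[R]_(n, m)) (k d : nat) : 'M[R]_(n, \sum_(i < d) m) :=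
  \mxrow_(i < d) (transition A (k + i.+1) (d - i.+1) *m B (k + i)%N).

(* There are d + 1 block rows, with indices 0, ..., d. *)
Definition obsmx (R : realType) n (A Q : nat -> 'M[R]_n) (k d : nat) :
    'M[R]_(\sum_(i < d.+1) n, n) :=
  \mxcol_(i < d.+1) (sqrt_psdmx (Q (k + i)%N) *m transition A k i).

Section Lifting.
Context (R : realType) (n m : nat).
Context (A : nat -> 'M[R]_n) (B : nat -> 'M[R]_(n, m)).
Context (Q : nat -> 'M[R]_n) (Rk : nat -> 'M[R]_m) (d t : nat).

Local Notation nd := (\sum_(i < d) n)%N.
Local Notation md := (\sum_(i < d) m)%N.

(* The lifted vectors of R^(n(d+1)) are split both as n + nd and as nd + n; the
   casts reconcile the two. *)
Definition hatA : 'M[R]_(n + nd) :=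
  1%:M - castmx (erefl, addnC nd n)
    (block_mx (0 : 'M_(n, nd)) (0 : 'M_(n, n))
              (blockdiag d (fun i => A (d * t + i)%N)) (0 : 'M_(nd, n))).

Definition hatB : 'M[R]_(n + nd, md) :=
  col_mx 0 (blockdiag d (fun i => B (d * t + i)%N)).

Definition hatC : 'M[R]_(nd, n + nd) :=
  castmx (erefl, addnC nd n)
    (row_mx (blockdiag d (fun i => sqrt_psdmx (Q (d * t + i)%N)))
            (0 : 'M_(nd, n))).

Definition first_block : 'M[R]_(n + nd, n) := col_mx 1%:M 0.

Definition last_block : 'M[R]_(n, n + nd) :=
  castmx (erefl, addnC nd n) (row_mx (0 : 'M_(n, nd)) 1%:M).

Definition lift_Phi : 'M[R]_n := last_block *m invmx hatA *m first_block.
Definition lift_Gamma : 'M[R]_(n, md) := last_block *m invmx hatA *m hatB.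
Definition lift_Xi : 'M[R]_(nd, n) := hatC *m invmx hatA *m first_block.
Definition lift_Delta : 'M[R]_(nd, md) := hatC *m invmx hatA *m hatB.

Definition tildeR : 'M[R]_md :=
  blockdiag d (fun i => Rk (d * t + i)%N) + lift_Delta^T *m lift_Delta.

Definition tildeQ : 'M[R]_n :=
  lift_Xi^T *m lift_Xi
  - lift_Xi^T *m lift_Delta *m invmx tildeR *m lift_Delta^T *m lift_Xi.

Definition tildeA : 'M[R]_n :=
  lift_Phi - lift_Gamma *m invmx tildeR *m lift_Delta^T *m lift_Xi.

Definition tildeB : 'M[R]_(n, md) := lift_Gamma.

End Lifting.

Definition riccati (R : realType) n p (A : 'M[R]_n) (B : 'M[R]_(n, p))
    (Q : 'M[R]_n) (S : 'M[R]_p) (P : 'M[R]_n) : 'M[R]_n :=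
  Q + A^T *m (P - P *m B *m invmx (S + B^T *m P *m B) *m B^T *m P) *m A.

Section RecedingHorizon.
Context (R : realType) (n p : nat).
Context (A : nat -> 'M[R]_n) (B : nat -> 'M[R]_(n, p)).
Context (Q : nat -> 'M[R]_n) (S : nat -> 'M[R]_p) (T : nat).

(* Time is counted relative to t: [rh_traj t chi w i] and [w`_i] are z_(t+i)
   and w_(t+i). *)
Fixpoint rh_traj (t : nat) (chi : 'cV[R]_n) (w : T.-tuple 'cV[R]_p) (i : nat) :
    'cV[R]_n :=
  if i is i'.+1 then A (t + i')%N *m rh_traj t chi w i' + B (t + i')%N *m w`_i'
  else chi.

Definition rh_cost (t : nat) (chi : 'cV[R]_n) (w : T.-tuple 'cV[R]_p)
    (X : 'M[R]_n) : R :=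
  \sum_(i < T) (qform (Q (t + i)%N) (rh_traj t chi w i)
                + qform (S (t + i)%N) w`_i)
  + qform X (rh_traj t chi w T).

(* [X k] is the matrix X_k, so the terminal penalty at time t is [X (t + T)]. *)
Definition rh_argmin (X : nat -> 'M[R]_n) (t : nat) (chi : 'cV[R]_n) :
    T.-tuple 'cV[R]_p :=
  xget [tuple of nseq T 0]
    [set w | forall w' : T.-tuple 'cV[R]_p,
               rh_cost t chi w (X (t + T)%N) <= rh_cost t chi w' (X (t + T)%N)].

Definition rh_policy (X : nat -> 'M[R]_n) (j t : nat) (chi : 'cV[R]_n) :
    'cV[R]_p := (rh_argmin X t chi)`_j.

End RecedingHorizon.

(* Exponential stability of the origin for x_(t+1) = f t (x_t). *)
Definition exp_stable (R : realType) n (f : nat -> 'cV[R]_n -> 'cV[R]_n) : Prop :=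
  exists c gamma : R, [/\ 0 < c, 0 < gamma < 1 &
    forall (t0 : nat) (x : nat -> 'cV[R]_n),
      (forall t, (t0 <= t)%N -> x t.+1 = f t (x t)) ->
      forall t, (t0 <= t)%N -> enorm (x t) <= c * gamma ^+ (t - t0) * enorm (x t0)].

(* Main.v *)
(* The optimal T-step cost V t x is a Lyapunov function.  It is at least
   x' tQ_t x >= q |x|^2.  It decreases by at least x' tQ_t x along the closed
   loop, because the optimal inputs at time t, shifted by one step and extended by
   the Riccati gain, are admissible at time t + 1, and the Riccati inequality says
   that this extension costs no more than the old terminal penalty.

   The matrices tA_t and tQ_t need not be estimated for the upper bound
   V t x <= c |x|^2, which would be awkward as R_k is not bounded away from 0.  The
   lifted system is the original one over d steps after the substitution
   w = u + tR^-1 Delta' Xi x, so the feedback w = tR^-1 Delta' Xi x is the zero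
   input u = 0: it gives the transition matrix Phi and the stage cost |Xi x|^2,
   and Phi and Xi are bounded since hatA is unitriangular, so that its inverse is
   its adjugate. *)
Require Import Defs.
From mathcomp Require Import all_boot all_order all_algebra.
From mathcomp Require Import perm.
From mathcomp Require Import boolp classical_sets reals.
From mathcomp Require Import ring lra.

Import Order.TTheory GRing.Theory Num.Theory.
Local Open Scope classical_set_scope.
Local Open Scope ring_scope.

Set Implicit Arguments.
Unset Strict Implicit.

(** * Quadratic forms *)

Section QuadraticForms.
Context (R : realType).

Definition sqn n (x : 'cV[R]_n) : R := \sum_i x i 0 ^+ 2.

Lemma sqn_ge0 n (x : 'cV[R]_n) : 0 <= sqn x.
Proof. by apply: sumr_ge0 => i _; exact: sqr_ge0. Qed.

Lemma sqn_eq0 n (x : 'cV[R]_n) : sqn x = 0 -> x = 0.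
Proof.
move=> /eqP; rewrite psumr_eq0 => [/allP x0|i _]; last exact: sqr_ge0.
apply/colP => i; rewrite mxE; apply/eqP; rewrite -sqrf_eq0.
by have /implyP := x0 i (mem_index_enum _); apply.
Qed.

Lemma sqnE n (x : 'cV[R]_n) : sqn x = (x^T *m x) 0 0.
Proof. by rewrite mxE; apply: eq_bigr => i _; rewrite mxE expr2. Qed.

Lemma qformD n (M N : 'M[R]_n) x : qform (M + N) x = qform M x + qform N x.
Proof. by rewrite /qform mulmxDr mulmxDl mxE. Qed.

Lemma qformB n (M N : 'M[R]_n) x : qform (M - N) x = qform M x - qform N x.
Proof. by rewrite /qform mulmxBr mulmxBl !mxE. Qed.

Lemma qform_scalar n (a : R) (x : 'cV[R]_n) : qform a%:M x = a * sqn x.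
Proof. by rewrite /qform mul_mx_scalar -scalemxAl mxE sqnE. Qed.

Lemma qform_sum n (I : Type) (r : seq I) (F : I -> 'M[R]_n) x :
  qform (\sum_(i <- r) F i) x = \sum_(i <- r) qform (F i) x.
Proof.
by rewrite /qform mulmx_sumr mulmx_suml summxE.
Qed.

Lemma qform_mulmx m n (M : 'M[R]_m) (F : 'M[R]_(m, n)) x :
  qform M (F *m x) = qform (F^T *m M *m F) x.
Proof. by rewrite /qform trmx_mul !mulmxA. Qed.

Lemma qform_gram m n (F : 'M[R]_(m, n)) x : qform (F^T *m F) x = sqn (F *m x).
Proof. by rewrite /qform sqnE trmx_mul !mulmxA. Qed.

Lemma qform_sym n (M : 'M[R]_n) (x y : 'cV[R]_n) : M^T = M ->
  (x^T *m M *m y) 0 0 = (y^T *m M *m x) 0 0.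
Proof.
move=> MT; transitivity ((x^T *m M *m y)^T 0 0); first by rewrite [RHS]mxE.
by rewrite !trmx_mul MT trmxK mulmxA.
Qed.

Lemma qform_line n (M : 'M[R]_n) (x y : 'cV[R]_n) (s : R) : M^T = M ->
  qform M (x + s *: y) =
    qform M x + s * ((x^T *m M *m y) 0 0 *+ 2) + s ^+ 2 * qform M y.
Proof.
have trD : (x + s *: y)^T = x^T + s *: y^T by rewrite linearD linearZ.
move=> MT; rewrite /qform trD !mulmxDl !mulmxDr -!scalemxAl.
rewrite -!scalemxAr; have := qform_sym y x MT.
move: (x^T *m _ *m x) (y^T *m _ *m y) (x^T *m _ *m y) (y^T *m _ *m x) => a b c e.
by rewrite !mxE => ->; ring.
Qed.

(** The polynomial [s |-> qform M (x + s *: y)] is nonnegative, which bounds its discriminant. *)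
Lemma psd_cauchy_schwarz n (M : 'M[R]_n) x y : psdmx M ->
  (x^T *m M *m y) 0 0 ^+ 2 <= qform M x * qform M y.
Proof.
move=> [MT M0]; set b : R := (_ *m y) 0 0.
have line s : 0 <= qform M x + s * (b *+ 2) + s ^+ 2 * qform M y.
  by rewrite -qform_line.
have := M0 x; have := M0 y; set p := qform M x in line *.
set r := qform M y in line * => r0 p0.
have [rz|rn] := eqVneq r 0.
  have [->|bn] := eqVneq b 0; first by rewrite expr0n mulr_ge0.
  (* The polynomial is affine here, and this [s] would give it the value -1. *)
  have := line (- (p + 1) / (b *+ 2)).
  rewrite mulfVK ?mulrn_eq0// rz mulr0 addr0 => h; exfalso; move: h; clear; lra.
(* Minimiser of the polynomial. *)
have := line (- b / r); have rp : 0 < r by rewrite lt0r rn.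
have -> : p + - b / r * (b *+ 2) + (- b / r) ^+ 2 * r = (p * r - b ^+ 2) / r.
  by field.
by rewrite pmulr_lge0 ?invr_gt0// subr_ge0.
Qed.

Lemma norm_qform_le n (M : 'M[R]_n) (c : R) x :
  (forall i j, `|M i j| <= c) -> `|qform M x| <= c * n%:R * sqn x.
Proof.
move=> Mc; rewrite /qform mxE.
(* Prepares the termwise comparison |x_i x_j| <= (x_i^2 + x_j^2) / 2. *)
have -> : c * n%:R * sqn x =
    \sum_(j < n) \sum_(i < n) c * ((x i 0 ^+ 2 + x j 0 ^+ 2) / 2).
  under eq_bigr do rewrite -mulr_sumr -mulr_suml big_split/= sumr_const card_ord.
  rewrite -mulr_sumr -mulr_suml big_split/= sumr_const card_ord sumrMnl -/(sqn x).
  by rewrite -mulr_natr; field.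
apply: le_trans (ler_norm_sum _ _ _) _; apply: ler_sum => j _.
rewrite mxE mulr_suml; apply: le_trans (ler_norm_sum _ _ _) _.
apply: ler_sum => i _; rewrite mxE !normrM -mulrA mulrCA.
apply: ler_pM => //; first by rewrite mulr_ge0.
rewrite -(real_normK (num_real (x i 0))) -(real_normK (num_real (x j 0))).
have := sqr_ge0 (`|x i 0| - `|x j 0|); nra.
Qed.

Lemma qform_bounded n (M : 'M[R]_n) :
  exists2 c, 0 < c & forall x, `|qform M x| <= c * sqn x.
Proof.
(* The sum of all absolute values dominates each entry; adding 1 makes the constant strictly
   positive. *)
exists ((\sum_i \sum_j `|M i j|) * n%:R + 1).
  by rewrite ltr_wpDl// mulr_ge0// sumr_ge0// => i _; rewrite sumr_ge0.
move=> x; apply: (@le_trans _ _ ((\sum_i \sum_j `|M i j|) * n%:R * sqn x)).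
  apply: norm_qform_le => i j; rewrite (bigD1 i)//= (bigD1 j)//= -addrA.
  rewrite lerDl addr_ge0//; first by rewrite sumr_ge0.
  by apply: sumr_ge0 => k _; rewrite sumr_ge0.
by rewrite ler_wpM2r ?sqn_ge0// lerDl.
Qed.

(** Cauchy-Schwarz with y = M^-1 x gives |x|^4 <= (x' M x)(y' M y), and y' M y is at most a constant
    times |x|^2. *)
Lemma psd_unit_coercive n (M : 'M[R]_n) : psdmx M -> M \in unitmx ->
  exists2 c, 0 < c & forall x, c * sqn x <= qform M x.
Proof.
move=> Mpsd Mu; have [c c0 Vc] := qform_bounded ((invmx M)^T).
exists c^-1 => [|x]; first by rewrite invr_gt0.
have := psd_cauchy_schwarz x (invmx M *m x) Mpsd.
rewrite -mulmxA mulKVmx// -sqnE qform_mulmx mulmxK//.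
have [->|xn] := eqVneq (sqn x) 0; first by rewrite mulr0 => _; case: Mpsd.
have xp : 0 < sqn x by rewrite lt0r xn sqn_ge0.
have := Vc x; rewrite ler_norml => /andP[_].
move=> Vx h; rewrite ler_pdivrMl// -(ler_pM2r xp) -expr2.
apply: (le_trans h); rewrite mulrAC [leLHS]mulrC.
by apply: ler_wpM2r => //; case: Mpsd.
Qed.

(* The supremum [s] of the shifts [s <= q] for which [M - s I] is positive
   semidefinite is [q]: otherwise [M - s I] is positive semidefinite and, [s] not
   being an eigenvalue, invertible, hence coercive, so a larger shift is possible. *)
Lemma eigenvalue_ge_qform n (M : 'M[R]_n) (q : R) : M^T = M ->
  (forall a, eigenvalue M a -> q <= a) -> forall x, q * sqn x <= qform M x.
Proof.
move=> MT Mq.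
pose E := [set s : R | s <= q /\ forall x, s * sqn x <= qform M x].
have E0 : E !=set0.
  have [c c0 Mc] := qform_bounded M; exists (Num.min q (- c)); split.
    by rewrite ge_min lexx.
  move=> x; apply: (@le_trans _ _ (- c * sqn x)).
    by rewrite ler_wpM2r ?sqn_ge0// ge_min lexx orbT.
  by have := Mc x; rewrite ler_norml mulNr => /andP[].
have Eub : ubound E q by move=> s [].
have sle : sup E <= q by apply: ge_sup.
have sup_qform x : sup E * sqn x <= qform M x.
  have [x0|xn] := eqVneq (sqn x) 0.
    by rewrite x0 mulr0 (sqn_eq0 x0) /qform mulmx0 mxE.
  have xp : 0 < sqn x by rewrite lt0r xn sqn_ge0.
  by rewrite -ler_pdivlMr//; apply: ge_sup => // s [_ /(_ x)]; rewrite ler_pdivlMr.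
move: sle; rewrite le_eqVlt => /predU1P[<-//|slt] x; exfalso.
pose N := M - (sup E)%:M.
have Npsd : psdmx N.
  by split=> [|y]; rewrite ?linearB/= ?tr_scalar_mx ?MT// qformB qform_scalar subr_ge0.
have Nunit : N \in unitmx.
  rewrite -row_free_unit -kermx_eq0; apply: contraTT slt => Nker.
  by rewrite -leNgt; apply: Mq.
have [c c0 Nc] := psd_unit_coercive Npsd Nunit.
have : E (Num.min q (sup E + c)).
  split=> [|y]; first by rewrite ge_min lexx.
  have := Nc y; rewrite qformB qform_scalar lerBrDl -mulrDl; apply: le_trans.
  by rewrite ler_wpM2r ?sqn_ge0// ge_min lexx orbT.
move=> /(ub_le_sup (ex_intro _ q Eub)); apply/negP; rewrite -ltNge lt_min slt/=.
by rewrite ltrDl.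
Qed.

(** [inf] takes the value 0 on sets without an infimum, so positivity excludes this default. *)
Lemma inf_gt0_lb (E : set R) : 0 < inf E -> lbound E (inf E).
Proof.
move=> E0; have [[_ Elb]|/inf_out Einf] := pselect (has_inf E).
  exact: ge_inf.
by rewrite Einf ltxx in E0.
Qed.

Lemma qform_ge_lambda_min n (M : 'M[R]_n) (q : R) :
  M^T = M -> 0 < q -> q <= lambda_min M -> forall x, q * sqn x <= qform M x.
Proof.
move=> MT q0 qM; apply: eigenvalue_ge_qform => // a Ma.
by apply: (le_trans qM); apply: inf_gt0_lb => //; exact: lt_le_trans qM.
Qed.

Lemma pdmx_psdmx n (M : 'M[R]_n) : pdmx M -> psdmx M.
Proof.
move=> [MT Mp]; split=> // x; have [->|/Mp/ltW//] := eqVneq x 0.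
by rewrite /qform mulmx0 mxE.
Qed.

Lemma pdmx_unit n (M : 'M[R]_n) : pdmx M -> M \in unitmx.
Proof.
move=> [MT Mp]; rewrite -row_free_unit -kermx_eq0.
apply/eqP/row_matrixP => i; rewrite row0; apply/eqP; apply: contraT => vn.
have := Mp (row i (kermx M))^T; rewrite trmx_eq0 => /(_ vn).
have -> : qform M (row i (kermx M))^T = 0; last by rewrite ltxx.
by rewrite /qform trmxK -row_mul mulmx_ker row0 mul0mx mxE.
Qed.

Lemma pdmxD_psdmx n (M N : 'M[R]_n) : pdmx M -> psdmx N -> pdmx (M + N).
Proof.
move=> [MT Mp] [NT Np]; split=> [|x xn]; first by rewrite linearD/= MT NT.
by rewrite qformD ltr_wpDr// Mp.
Qed.

Lemma psdmx_congr m n (M : 'M[R]_m) (F : 'M[R]_(m, n)) :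
  psdmx M -> psdmx (F^T *m M *m F).
Proof.
move=> [MT Mp]; split=> [|x]; last by rewrite -qform_mulmx.
by rewrite !trmx_mul MT trmxK mulmxA.
Qed.

Lemma psdmx_gram m n (F : 'M[R]_(m, n)) : psdmx (F^T *m F).
Proof.
by split=> [|x]; rewrite ?qform_gram ?sqn_ge0// trmx_mul trmxK.
Qed.

End QuadraticForms.

(** * Entrywise bounded sequences of matrices *)

Section EntrywiseBounds.
Context (R : realType).

(** Entrywise bounds pass directly through blocks, casts, products and adjugates; the spectral norm
    enters only through [entry_le_specnorm]. *)
Definition ebounded m n (M : nat -> 'M[R]_(m, n)) : Prop :=
  exists2 c, 0 <= c & forall k i j, `|M k i j| <= c.

Lemma ebounded_const m n (M : 'M[R]_(m, n)) : ebounded (fun=> M).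
Proof.
exists (\sum_i \sum_j `|M i j|) => [|_ i j].
  by apply: sumr_ge0 => i _; exact: sumr_ge0.
rewrite (bigD1 i)//= (bigD1 j)//= -addrA lerDl addr_ge0//; first exact: sumr_ge0.
by apply: sumr_ge0 => k _; exact: sumr_ge0.
Qed.

Lemma eboundedD m n (M N : nat -> 'M[R]_(m, n)) :
  ebounded M -> ebounded N -> ebounded (fun k => M k + N k).
Proof.
move=> [a a0 Ma] [b b0 Nb]; exists (a + b) => [|k i j]; first exact: addr_ge0.
by rewrite mxE (le_trans (ler_normD _ _))// lerD.
Qed.

Lemma eboundedN m n (M : nat -> 'M[R]_(m, n)) :
  ebounded M -> ebounded (fun k => - M k).
Proof. by move=> [a a0 Ma]; exists a => // k i j; rewrite mxE normrN. Qed.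

Lemma eboundedM m n p (M : nat -> 'M[R]_(m, n)) (N : nat -> 'M[R]_(n, p)) :
  ebounded M -> ebounded N -> ebounded (fun k => M k *m N k).
Proof.
move=> [a a0 Ma] [b b0 Nb]; exists (\sum_(i < n) a * b) => [|k i j].
  by apply: sumr_ge0 => i _; exact: mulr_ge0.
rewrite mxE (le_trans (ler_norm_sum _ _ _))//; apply: ler_sum => l _.
by rewrite normrM ler_pM.
Qed.

Lemma ebounded_tr m n (M : nat -> 'M[R]_(m, n)) :
  ebounded M -> ebounded (fun k => (M k)^T).
Proof. by move=> [a a0 Ma]; exists a => // k i j; rewrite mxE. Qed.

Lemma ebounded_sum m n N (M : 'I_N -> nat -> 'M[R]_(m, n)) :
  (forall l, ebounded (M l)) -> ebounded (fun k => \sum_l M l k).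
Proof.
elim: N M => [|N IH] M Mb.
  by exists 0 => // k i j; rewrite big_ord0 mxE normr0.
have [c c0 Mc] :=
  eboundedD (IH (M \o widen_ord (leqnSn N)) (fun l => Mb _)) (Mb ord_max).
by exists c => // k i j; rewrite big_ord_recr; exact: Mc.
Qed.

Lemma ebounded_comp m n (M : nat -> 'M[R]_(m, n)) (f : nat -> nat) :
  ebounded M -> ebounded (M \o f).
Proof. by move=> [a a0 Ma]; exists a => // k i j; exact: Ma. Qed.

Lemma ebounded_cast m n m' n' (e : (m = m') * (n = n')) (M : nat -> 'M[R]_(m, n)) :
  ebounded M -> ebounded (fun k => castmx e (M k)).
Proof. by move=> [a a0 Ma]; exists a => // k i j; rewrite castmxE. Qed.

Lemma ebounded_row m n p (M : nat -> 'M[R]_(m, n)) (N : nat -> 'M[R]_(m, p)) :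
  ebounded M -> ebounded N -> ebounded (fun k => row_mx (M k) (N k)).
Proof.
move=> [a a0 Ma] [b b0 Nb]; exists (a + b) => [|k i j]; first exact: addr_ge0.
rewrite mxE; case: splitP => l _.
  by rewrite (le_trans (Ma _ _ _))// lerDl.
by rewrite (le_trans (Nb _ _ _))// lerDr.
Qed.

Lemma ebounded_col m n p (M : nat -> 'M[R]_(m, n)) (N : nat -> 'M[R]_(p, n)) :
  ebounded M -> ebounded N -> ebounded (fun k => col_mx (M k) (N k)).
Proof.
move=> [a a0 Ma] [b b0 Nb]; exists (a + b) => [|k i j]; first exact: addr_ge0.
rewrite mxE; case: splitP => l _.
  by rewrite (le_trans (Ma _ _ _))// lerDl.
by rewrite (le_trans (Nb _ _ _))// lerDr.
Qed.

Lemma ebounded_blockdiag d m n (M : nat -> 'M[R]_(m, n)) (f : nat -> nat -> nat) :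
  ebounded M -> ebounded (fun t => blockdiag d (fun i => M (f t i))).
Proof.
move=> [a a0 Ma]; exists a => // t i j; rewrite mxE.
by case: eqP => _; rewrite ?mxE ?normr0.
Qed.

Lemma det_le n (M : 'M[R]_n) (c : R) :
  (forall i j, `|M i j| <= c) -> `|\det M| <= \sum_(s : 'S_n) c ^+ n.
Proof.
move=> Mc; apply: le_trans (ler_norm_sum _ _ _) _; apply: ler_sum => s _.
rewrite normrM normrX normrN1 expr1n mul1r normr_prod.
have -> : c ^+ n = \prod_(i < n) c by rewrite prodr_const card_ord.
by apply: ler_prod => i _; rewrite normr_ge0 Mc.
Qed.

Lemma ebounded_adj n (M : nat -> 'M[R]_n) :
  ebounded M -> ebounded (fun k => \adj (M k)).
Proof.
move=> [a a0 Ma]; exists (\sum_(s : 'S_n.-1) a ^+ n.-1) => [|k i j].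
  by apply: sumr_ge0 => s _; exact: exprn_ge0.
rewrite mxE normrM normrX normrN1 expr1n mul1r.
by apply: det_le => r s; rewrite !mxE.
Qed.

Lemma sqr_entry_le_sqn n (x : 'cV[R]_n) i : x i 0 ^+ 2 <= sqn x.
Proof.
by rewrite /sqn (bigD1 i)//= lerDl; apply: sumr_ge0 => j _; exact: sqr_ge0.
Qed.

(** The entry is a coordinate of the image of the unit vector e_j. *)
Lemma entry_le_specnorm m n (M : 'M[R]_(m, n)) i j : `|M i j| <= specnorm M.
Proof.
have [c c0 Mc] := qform_bounded (M^T *m M).
apply: (@le_trans _ _ (enorm (M *m delta_mx j 0))).
  rewrite -colE /enorm -sqrtr_sqr ler_sqrt.
    by rewrite -/(sqn _) (le_trans _ (sqr_entry_le_sqn _ i))// mxE.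
  exact: sqn_ge0.
apply: ub_le_sup; last first.
  exists (delta_mx j 0) => //=; rewrite /enorm (bigD1 j)//= big1 => [|k kj].
    by rewrite mxE !eqxx expr1n addr0 sqrtr1.
  by rewrite mxE (negPf kj) expr0n.
(* The supremum is an upper bound only if the set is bounded, which follows from |M x|^2 <= c
   |x|^2. *)
exists (Num.sqrt c) => _ [x /= x1 <-]; rewrite /enorm ler_sqrt ?(ltW c0)// -/(sqn _).
rewrite -qform_gram; apply: (le_trans (ler_norm _)); apply: (le_trans (Mc x)).
have : Num.sqrt (sqn x) <= Num.sqrt 1 by rewrite sqrtr1.
by rewrite ler_sqrt// => sqn1; rewrite ler_piMr ?(ltW c0).
Qed.

Lemma unif_bounded_ebounded m n (M : nat -> 'M[R]_(m, n)) :
  unif_bounded M -> ebounded M.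
Proof.
move=> [c Mc]; exists `|c| => // k i j.
exact: le_trans (entry_le_specnorm _ _ _) (le_trans (Mc k) (ler_norm c)).
Qed.

(** For a symmetric root S of M, column j of S has squared norm M_jj. Without a root, the default is
    0. The bound c + 1 dominates every a >= 0 with a^2 <= c. *)
Lemma ebounded_sqrt n (M : nat -> 'M[R]_n) :
  ebounded M -> ebounded (fun k => sqrt_psdmx (M k)).
Proof.
move=> [c c0 Mc]; exists (c + 1) => [|k i j]; first exact: addr_ge0.
rewrite /sqrt_psdmx; case: xgetP => [S _ [[ST _] SS]|_]; last first.
  by rewrite mxE normr0 addr_ge0.
have : S i j ^+ 2 <= c.
  apply: le_trans (le_trans (ler_norm _) (Mc k j j)).
  have -> : S i j = col j S i 0 by rewrite mxE.
  apply: le_trans (sqr_entry_le_sqn _ _) _.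
  rewrite -SS mxE; apply: ler_sum => l _.
  by rewrite !mxE -[in X in _ <= X * _]ST mxE expr2.
rewrite -real_normK ?num_real//; have := normr_ge0 (S i j); move: c0 `|S i j|.
clear => c0 a; nra.
Qed.

End EntrywiseBounds.

(** * Lifted data *)

Section Lifting.
Context (R : realType).

Lemma tr_blockdiag d n (F : nat -> 'M[R]_n) : (forall i, (F i)^T = F i) ->
  (blockdiag d F)^T = blockdiag d F.
Proof.
move=> FT; rewrite /blockdiag tr_mxblock; apply: eq_mxblock => i j.
by rewrite eq_sym; case: eqP => [->|_]; rewrite ?FT// trmx0.
Qed.

Lemma pdmx_blockdiag d n (F : nat -> 'M[R]_n) : (forall i, pdmx (F i)) ->
  pdmx (blockdiag d F).
Proof.
move=> Fp; split=> [|x xn]; first by apply: tr_blockdiag => i; case: (Fp i).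
have qE : qform (blockdiag d F) x = \sum_(i < d) qform (F i) (submxcol x i).
  rewrite /qform -[in LHS](submxcolK x) tr_mxcol -mulmxA /blockdiag.
  rewrite mul_mxblock_mxrow mul_mxrow_mxcol summxE; apply: eq_bigr => i _.
  rewrite (bigD1 i)//= eqxx big1 ?addr0 ?mulmxA// => j ji.
  by rewrite eq_sym (negPf ji) mul0mx.
have F0 (i : 'I_d) : 0 <= qform (F i) (submxcol x i) by case: (pdmx_psdmx (Fp i)).
rewrite qE lt0r sumr_ge0// andbT psumr_eq0//; apply: contraNN xn => /allP x0.
rewrite -(submxcolK x); apply/eqP/mxcolP => i; rewrite mxcolK submxcol0.
apply/eqP; apply: contraT => /((Fp i).2 _).
by have /eqP -> := x0 i (mem_index_enum _); rewrite ltxx.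
Qed.

Context (n : nat) (A Q : nat -> 'M[R]_n) (d : nat).

(** The cast keeps numerical indices, so each block A_k occupies rows placed n below its columns,
    strictly under the diagonal. *)
Lemma hatA_unitriangular t (i j : 'I_(n + \sum_(_ < d) n)) :
  (i <= j)%N -> hatA A d t i j = (i == j)%:R.
Proof.
move=> ij; rewrite /hatA 2!mxE mxE castmxE/=.
set K := block_mx _ _ _ _; set a := cast_ord _ i; set b := cast_ord _ j.
suff -> : K a b = 0 by rewrite subr0.
have : (a <= b)%N by [].
rewrite /K /block_mx mxE; case: splitP => k ak.
  by rewrite mxE; case: splitP => l _; rewrite mxE.
rewrite mxE; case: splitP => l bl; rewrite ?mxE// ak bl => kl.
(* Two indices [k] and [l] in the same block of size [n] satisfy l < n + k. *)
case: eqP => [kl1|_]; rewrite ?mxE//; exfalso; move: kl; apply/negP; rewrite -ltnNge.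
rewrite (tagnat.rect l) (tagnat.rect k) kl1.
by rewrite [ltnRHS]addnCA ltn_add2l ltn_addr.
Qed.

Lemma det_hatA t : \det (hatA A d t) = 1.
Proof.
rewrite det_trig; first by rewrite big1// => i _; rewrite hatA_unitriangular// eqxx.
apply/is_trig_mxP => i j ij; rewrite hatA_unitriangular; last exact: ltnW.
have /negPf -> // : i != j.
by rewrite neq_ltn ij.
Qed.

Lemma invmx_hatA t : invmx (hatA A d t) = \adj (hatA A d t).
Proof. by rewrite /invmx unitmxE det_hatA unitr1 invr1 scale1r. Qed.

Hypothesis A_bounded : ebounded A.

Lemma ebounded_inv_hatA : ebounded (fun t => invmx (hatA A d t)).
Proof.
suff [c c0 adjc] : ebounded (fun t => \adj (hatA A d t)).
  by exists c => // t i j; rewrite invmx_hatA.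
apply/ebounded_adj/eboundedD; first exact: ebounded_const.
apply/eboundedN/ebounded_cast; apply: ebounded_col.
  exact: ebounded_const.
by apply: ebounded_row; [exact: ebounded_blockdiag|exact: ebounded_const].
Qed.

Lemma ebounded_Phi : ebounded (lift_Phi A d).
Proof.
apply: eboundedM (ebounded_const _); apply: eboundedM (ebounded_const _) _.
exact: ebounded_inv_hatA.
Qed.

Lemma ebounded_Xi : ebounded Q -> ebounded (lift_Xi A Q d).
Proof.
move=> Qb; apply: eboundedM (ebounded_const _); apply: eboundedM ebounded_inv_hatA.
apply: ebounded_cast; apply: ebounded_row (ebounded_const _).
exact: (ebounded_blockdiag _ _ (ebounded_sqrt Qb)).
Qed.

End Lifting.

(** * Cancellation of the correction terms by the zero-input feedback *)

Section LiftedData.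
Context (R : realType) (n m : nat) (A : nat -> 'M[R]_n) (B : nat -> 'M[R]_(n, m)).
Context (Q : nat -> 'M[R]_n) (Rk : nat -> 'M[R]_m) (d t : nat).
Hypothesis Rk_pd : forall k, pdmx (Rk k).

Local Notation tR := (tildeR A B Q Rk d t).
Local Notation tQ := (tildeQ A B Q Rk d t).
Local Notation Xi := (lift_Xi A Q d t).
Local Notation Delta := (lift_Delta A B Q d t).

Definition zero_input_gain : 'M[R]_(\sum_(i < d) m, n) :=
  invmx tR *m Delta^T *m Xi.

Lemma tildeR_pd : pdmx tR.
Proof.
apply: pdmxD_psdmx; last exact: psdmx_gram.
by apply: (@pdmx_blockdiag _ _ _ (fun i => Rk (d * t + i)%N)).
Qed.

Lemma tr_inv_tildeR : (invmx tR)^T = invmx tR.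
Proof. by rewrite trmx_inv; have [-> _] := tildeR_pd. Qed.

Lemma tildeQ_sym : tQ^T = tQ.
Proof.
by rewrite /tildeQ linearB/= !trmx_mul !trmxK tr_inv_tildeR !mulmxA.
Qed.

Lemma zero_input_dynamics :
  tildeA A B Q Rk d t + tildeB A B d t *m zero_input_gain = lift_Phi A d t.
Proof. by rewrite /tildeA /tildeB /zero_input_gain !mulmxA subrK. Qed.

(** With K the gain, K' tR K = Xi' Delta tR^-1 Delta' Xi, exactly the term subtracted in
    [tildeQ]. *)
Lemma zero_input_stage :
  tQ + zero_input_gain^T *m tR *m zero_input_gain = Xi^T *m Xi.
Proof.
rewrite /tildeQ /zero_input_gain !trmx_mul !trmxK tr_inv_tildeR !mulmxA.
by rewrite mulmxKV ?subrK// pdmx_unit//; exact: tildeR_pd.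
Qed.

End LiftedData.

(** * Riccati operator and finite-horizon costs *)

Section Riccati.
Context (R : realType) (n p : nat).
Context (A : 'M[R]_n) (B : 'M[R]_(n, p)) (Q : 'M[R]_n) (S : 'M[R]_p) (P : 'M[R]_n).
Hypothesis S_pd : pdmx S.
Hypothesis P_psd : psdmx P.

Local Notation H := (S + B^T *m P *m B).

Lemma riccati_denominator_pd : pdmx H.
Proof. exact: pdmxD_psdmx S_pd (psdmx_congr _ P_psd). Qed.

Definition riccati_gain : 'M[R]_(p, n) := - (invmx H *m B^T *m P *m A).

(** Completion of the square in [w]: it yields both the minimal one-step cost and the minimising
    gain. *)
Lemma riccati_square x w :
  qform Q x + qform S w + qform P (A *m x + B *m w) =
  qform (riccati A B Q S P) x + qform H (w - riccati_gain *m x).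
Proof.
have [PT _] := P_psd; have [HT _] := riccati_denominator_pd.
have Hu := pdmx_unit riccati_denominator_pd.
set y := A *m x; set g := invmx H *m (B^T *m (P *m y)).
(* The scalar 1 puts the sum in the form expected by [qform_line]. *)
have -> : w - riccati_gain *m x = w + 1 *: g.
  by rewrite /riccati_gain mulNmx opprK scale1r /g /y !mulmxA.
rewrite -[B *m w]scale1r !qform_line// qform_mulmx.
rewrite /riccati [qform (Q + _) x]qformD.
rewrite -[qform (A^T *m _ *m A) x]qform_mulmx -/y qformB.
have -> : qform (P *m B *m invmx H *m B^T *m P) y = qform H g.
  rewrite qform_mulmx !mulmxA; congr (_ _ 0 0).
  rewrite /g /qform !trmx_mul trmxK PT trmx_inv HT !mulmxA.
  by rewrite mulmxKV.
have -> : (w^T *m H *m g) 0 0 = (y^T *m P *m (B *m w)) 0 0.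
  rewrite (qform_sym y _ PT) trmx_mul -[w^T *m H *m g]mulmxA /g mulKVmx//.
  by rewrite !mulmxA.
rewrite [qform H w]qformD; ring.
Qed.

Lemma qform_riccati x :
  qform Q x + qform S (riccati_gain *m x)
    + qform P (A *m x + B *m (riccati_gain *m x)) = qform (riccati A B Q S P) x.
Proof. by rewrite riccati_square subrr /qform mulmx0 [X in _ + X]mxE addr0. Qed.

Lemma qform_riccati_le x w :
  qform (riccati A B Q S P) x <= qform Q x + qform S w + qform P (A *m x + B *m w).
Proof.
by rewrite riccati_square lerDl; case: (pdmx_psdmx riccati_denominator_pd).
Qed.

(** Despite the subtraction in the formula, the form is a sum of nonnegative costs under the Riccati
    gain. *)
Lemma riccati_psd : psdmx Q -> psdmx (riccati A B Q S P).
Proof.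
move=> [QT Q0]; have [PT P0] := P_psd; have [HT _] := riccati_denominator_pd.
split=> [|x].
  rewrite /riccati linearD/= !trmx_mul linearB/= !trmx_mul !trmxK trmx_inv HT.
  by rewrite PT QT !mulmxA.
by rewrite -qform_riccati !addr_ge0//; have [] := pdmx_psdmx S_pd.
Qed.

End Riccati.

(** * Finite-horizon costs and dynamic programming *)

Section FiniteHorizon.
Context (R : realType) (n p : nat).
Context (A : nat -> 'M[R]_n) (B : nat -> 'M[R]_(n, p)).
Context (Q : nat -> 'M[R]_n) (S : nat -> 'M[R]_p).
Hypothesis Q_psd : forall t, psdmx (Q t).
Hypothesis S_pd : forall t, pdmx (S t).

Local Notation cost := (rh_cost A B Q S).

Lemma rh_traj_cons T t chi u (w : T.-tuple 'cV[R]_p) i :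
  rh_traj A B t chi [tuple of u :: w] i.+1 =
  rh_traj A B t.+1 (A t *m chi + B t *m u) w i.
Proof.
elim: i => [|i IH]; first by rewrite /= addn0.
by rewrite [LHS]/= -/(rh_traj A B t chi [tuple of u :: w] i.+1) IH addnS.
Qed.

Lemma rh_cost_cons T t chi u (w : T.-tuple 'cV[R]_p) X :
  cost t chi [tuple of u :: w] X =
  qform (Q t) chi + qform (S t) u + cost t.+1 (A t *m chi + B t *m u) w X.
Proof.
rewrite /rh_cost big_ord_recl addn0 -addrA; congr (_ + (_ + _)).
  by apply: eq_bigr => i _; rewrite lift0 rh_traj_cons addSnnS.
by rewrite rh_traj_cons.
Qed.

Lemma rh_cost0 t chi (w : 0.-tuple 'cV[R]_p) X : cost t chi w X = qform X chi.
Proof. by rewrite /rh_cost big_ord0 add0r. Qed.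

Lemma rh_cost_ge0 T t chi (w : T.-tuple 'cV[R]_p) X : psdmx X -> 0 <= cost t chi w X.
Proof.
move=> [_ X0]; rewrite /rh_cost addr_ge0// sumr_ge0// => i _.
by rewrite addr_ge0//; [case: (Q_psd (t + i)%N)|case: (pdmx_psdmx (S_pd (t + i)%N))].
Qed.

(** Dynamic programming: [V] is the backward Riccati iterate started from [X]. Attainment of the
    minimum matters because [rh_argmin] is defined by choice with a default. *)
Lemma rh_value T t X : psdmx X -> exists2 V, psdmx V &
  forall chi, (forall w : T.-tuple 'cV[R]_p, qform V chi <= cost t chi w X) /\
    exists w : T.-tuple 'cV[R]_p, cost t chi w X = qform V chi.
Proof.
move=> X_psd; elim: T t => [|T IH] t.
  exists X => // chi; split=> [w|]; first by rewrite rh_cost0.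
  by exists [tuple]; rewrite rh_cost0.
have [V V_psd VP] := IH t.+1.
exists (riccati (A t) (B t) (Q t) (S t) V) => [|chi]; first exact: riccati_psd.
split=> [w|].
  case/tupleP: w => u w; rewrite rh_cost_cons.
  apply: le_trans (qform_riccati_le _ _ _ (S_pd t) V_psd _ u) _.
  by rewrite lerD2l; have [] := VP (A t *m chi + B t *m u).
pose u := riccati_gain (A t) (B t) (S t) V *m chi.
have [_ [w wV]] := VP (A t *m chi + B t *m u).
by exists [tuple of u :: w]; rewrite rh_cost_cons wV qform_riccati.
Qed.

Lemma rh_argminP T X t chi (w : T.-tuple 'cV[R]_p) : psdmx (X (t + T)%N) ->
  cost t chi (rh_argmin A B Q S T X t chi) (X (t + T)%N) <= cost t chi w (X (t + T)%N).
Proof.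
move=> X_psd; have [V _ /(_ chi)[Vle [w0 w0V]]] := rh_value T t X_psd.
rewrite /rh_argmin; case: xgetP => [w1 _|/(_ w0)[]]; first exact.
by move=> w'; rewrite w0V.
Qed.

(** One input [v] is appended at the final state [z], where its stage cost and the new penalty
    replace [X]. The induction removes inputs from the front, so the common stage costs cancel. *)
Lemma rh_cost_extend T t X X' chi (w : T.-tuple 'cV[R]_p) :
  (forall z, exists v, qform (Q (t + T)%N) z + qform (S (t + T)%N) v
     + qform X' (A (t + T)%N *m z + B (t + T)%N *m v) <= qform X z) ->
  exists w' : T.+1.-tuple 'cV[R]_p, cost t chi w' X' <= cost t chi w X.
Proof.
elim: T t chi w => [|T IH] t chi w ext.
  have [v] := ext chi; rewrite addn0 => vP; exists [tuple of v :: w].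
  by rewrite rh_cost_cons !rh_cost0.
case/tupleP: w => u w.
have [|w' w'P] := IH t.+1 (A t *m chi + B t *m u) w; first by rewrite addSnnS.
by exists [tuple of u :: w']; rewrite [leLHS]rh_cost_cons rh_cost_cons lerD2l.
Qed.

(** * Cost of a linear feedback *)

Section LinearFeedback.
Context (K : nat -> 'M[R]_(p, n)).

Local Notation Acl := (fun t => A t + B t *m K t).

Definition feedback_cost T t X : 'M[R]_n :=
  \sum_(i < T) ((transition Acl t i)^T
     *m (Q (t + i)%N + (K (t + i)%N)^T *m S (t + i)%N *m K (t + i)%N)
     *m transition Acl t i)
  + (transition Acl t T)^T *m X *m transition Acl t T.

Lemma rh_cost_feedback T t chi X :
  exists w : T.-tuple 'cV[R]_p, cost t chi w X = qform (feedback_cost T t X) chi.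
Proof.
(* Open-loop inputs that the feedback generates from [chi]. *)
pose u i := K (t + i)%N *m (transition Acl t i *m chi).
exists [tuple of mkseq u T].
have trajE i : (i <= T)%N ->
    rh_traj A B t chi [tuple of mkseq u T] i = transition Acl t i *m chi.
  elim: i => [_|i IH iT]; first by rewrite /= mul1mx.
  rewrite /= IH 1?ltnW// nth_mkseq// /u mulmxDl.
  by rewrite !mulmxA -mulmxDl.
rewrite /rh_cost /feedback_cost qformD qform_sum trajE// -!qform_mulmx.
congr (_ + _); apply: eq_bigr => i _.
rewrite trajE 1?ltnW// nth_mkseq// -qform_mulmx qformD; congr (_ + _).
by rewrite -qform_mulmx.
Qed.

(** The bounds are asked of the closed-loop combinations, which the zero-input feedback turns into
    Phi and Xi' Xi. *)
Lemma ebounded_feedback_cost T (X : nat -> 'M[R]_n) :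
  ebounded Acl -> ebounded (fun t => Q t + (K t)^T *m S t *m K t) -> ebounded X ->
  ebounded (fun t => feedback_cost T t (X t)).
Proof.
move=> Ab Qb Xb.
have Psib i : ebounded (fun t => transition Acl t i).
  elim: i => [|i IH]; first exact: ebounded_const.
  by apply: eboundedM IH; exact: (ebounded_comp (addn^~ i) Ab).
apply: eboundedD; last first.
  by apply: eboundedM (Psib T); apply: eboundedM Xb; exact: ebounded_tr.
apply: ebounded_sum => i; apply: eboundedM (Psib i).
apply: eboundedM; first exact: ebounded_tr.
exact: (ebounded_comp (addn^~ i) Qb).
Qed.

End LinearFeedback.

End FiniteHorizon.

(** * Stability *)

Section Stability.
Context (R : realType).

(** Since |x|^2 >= V / C, the decrease gives V_(t+1) <= (1 - q / C) V_t, a geometric decay. *)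
Lemma lyapunov_exp_stable n (f : nat -> 'cV[R]_n -> 'cV[R]_n)
    (V : nat -> 'cV[R]_n -> R) (q c : R) : 0 < q ->
  (forall t x, q * sqn x <= V t x) -> (forall t x, V t x <= c * sqn x) ->
  (forall t x, V t.+1 (f t x) + q * sqn x <= V t x) -> exp_stable f.
Proof.
move=> q0 Vlow Vup Vdecr.
(* [C] dominates [c] and exceeds [q], so that 0 < r < 1. *)
pose C := q + `|c|+ 1; pose r := 1 - q / C.
have c0 : 0 <= `|c| by [].
have C0 : 0 < C by rewrite /C; move: c0 q0; clear; lra.
have VC t x : V t x <= C * sqn x.
  apply: le_trans (Vup t x) _; rewrite ler_wpM2r ?sqn_ge0//.
  by rewrite /C; have := ler_norm c; move: q0; clear; lra.
have r0 : 0 < r by rewrite subr_gt0 ltr_pdivrMr// mul1r /C -addrA ltrDl ltr_wpDl.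
have r1 : r < 1 by rewrite gtrDl oppr_lt0 divr_gt0.
(* Square roots appear because [V] is comparable to the squared norm. *)
exists (Num.sqrt (C / q)), (Num.sqrt r); split.
- by rewrite sqrtr_gt0 divr_gt0.
- by rewrite sqrtr_gt0 r0/= -sqrtr1 ltr_sqrt.
move=> t0 x xf t /subnKC <-; move: (t - t0)%N => k; rewrite addKn.
have Vk : V (t0 + k)%N (x (t0 + k)%N) <= r ^+ k * V t0 (x t0).
  elim: k => [|k IH]; first by rewrite addn0 mul1r.
  rewrite addnS xf ?leq_addr// exprS -mulrA.
  apply: (@le_trans _ _ (r * V (t0 + k)%N (x (t0 + k)%N))); last by rewrite ler_pM2l.
  have := Vdecr (t0 + k)%N (x (t0 + k)%N); have := VC (t0 + k)%N (x (t0 + k)%N).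
  set v := V _ (x _); set v' := V _ (f _ _); set s := sqn _ => vC v's.
  have : q / C * v <= q * s.
    by rewrite mulrAC ler_pdivrMr// -mulrA ler_pM2l// [s * C]mulrC.
  by rewrite /r mulrBl mul1r; move: v's; clear; lra.
have := le_trans (Vlow _ _)
  (le_trans Vk (ler_wpM2l (exprn_ge0 k (ltW r0)) (VC t0 (x t0)))).
rewrite -ler_pdivlMl// => xk.
rewrite /enorm -!/(sqn _).
have -> : Num.sqrt r ^+ k = Num.sqrt (r ^+ k).
  elim: k {Vk xk} => [|k IH]; first by rewrite !expr0 sqrtr1.
  by rewrite !exprS IH sqrtrM// ltW.
have rk0 : 0 <= r ^+ k by rewrite exprn_ge0// ltW.
have Cq0 : 0 <= C / q by rewrite divr_ge0// ltW.
rewrite -sqrtrM// -sqrtrM ?(mulr_ge0 Cq0 rk0)//; apply: ler_wsqrtr.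
apply: (le_trans xk).
by rewrite [leLHS](_ : _ = C / q * r ^+ k * sqn (x t0))//; ring.
Qed.

Context (n p : nat) (A : nat -> 'M[R]_n) (B : nat -> 'M[R]_(n, p)).
Context (Q : nat -> 'M[R]_n) (S : nat -> 'M[R]_p) (K : nat -> 'M[R]_(p, n)).
Context (T : nat) (X : nat -> 'M[R]_n).

(** The gain [K] is a comparison feedback, used to bound the optimal cost from above. *)
Lemma receding_horizon_exp_stable (q : R) : 0 < q ->
  (forall t, psdmx (Q t)) -> (forall t x, q * sqn x <= qform (Q t) x) ->
  (forall t, pdmx (S t)) ->
  ebounded (fun t => A t + B t *m K t) ->
  ebounded (fun t => Q t + (K t)^T *m S t *m K t) ->
  (0 < T)%N -> (forall t, psdmx (X (t + T)%N)) -> ebounded (fun t => X (t + T)%N) ->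
  (forall t, loewner_le (riccati (A (t + T)%N) (B (t + T)%N) (Q (t + T)%N)
     (S (t + T)%N) (X (t + T).+1)) (X (t + T)%N)) ->
  exp_stable (fun t x => A t *m x + B t *m rh_policy A B Q S T X 0 t x).
Proof.
move=> q0 Qpsd Qq Spd Acl Qcl T0 Xpsd Xb Xric.
pose V t x := rh_cost A B Q S t x (rh_argmin A B Q S T X t x) (X (t + T)%N).
have [c c0 cP] := ebounded_feedback_cost T Acl Qcl Xb.
have argminP t x (w : T.-tuple 'cV[R]_p) :
    V t x <= rh_cost A B Q S t x w (X (t + T)%N).
  exact: (rh_argminP A B Qpsd Spd).
apply: (@lyapunov_exp_stable _ _ V q (c * n%:R)) => // t x.
(* Lower bound: as [T] is positive, the cost contains the stage term at [x]. *)
- rewrite /V; move: (rh_argmin _ _ _ _ _ _ _ _) (Xpsd t) T0.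
  case: {argminP V Xpsd Xb Xric cP} T => // T' w XT _; case/tupleP: w => u w.
  rewrite rh_cost_cons -addrA (le_trans (Qq t x))// lerDl addr_ge0//.
    by have [] := pdmx_psdmx (Spd t).
  exact: rh_cost_ge0.
- have [w wE] := rh_cost_feedback A B Q S K T t x (X (t + T)%N).
  apply: le_trans (argminP t x w) _; rewrite wE.
  exact: le_trans (ler_norm _) (norm_qform_le _ (cP t)).
(* Decrease: the optimal inputs are split into the applied input [u] and the tail [w], whose T - 1
   inputs start at t + 1 and lead to the state at time t + T. *)
rewrite {2}/V /rh_policy; move: {argminP} (argminP t.+1) (Xric t) (Xpsd t.+1).
move: (V t.+1) (rh_argmin _ _ _ _ _ _ _ _) T0 => V'.
case: {V Xric Xpsd Xb cP} T => // T' w _; case/tupleP: w => u w /= V'P Xric Xpsd.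
rewrite rh_cost_cons.
have [|w' w'P] := @rh_cost_extend _ _ _ A B Q S T' t.+1 (X (t + T'.+1)%N)
    (X (t + T'.+1).+1) (A t *m x + B t *m u) w.
  (* At time t + T the Riccati gain attains the Riccati value, which is at most the old penalty. *)
  rewrite addSnnS => z; exists (riccati_gain (A (t + T'.+1)%N) (B (t + T'.+1)%N)
    (S (t + T'.+1)%N) (X (t + T'.+1).+1) *m z).
  rewrite qform_riccati// -subr_ge0 -qformB.
  by have [_] := Xric; apply.
have S0 : 0 <= qform (S t) u by have [] := pdmx_psdmx (Spd t).
have := le_trans (V'P _ w') w'P; have := Qq t x; move: S0; clear; lra.
Qed.

End Stability.

Unset Implicit Arguments.
Set Strict Implicit.

Theorem theorem1 (R : realType) (n m : nat) (n_gt0 : (0 < n)%N) (m_gt0 : (0 < m)%N)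
    (A : nat -> 'M[R]_n) (B : nat -> 'M[R]_(n, m))
    (Q : nat -> 'M[R]_n) (Rk : nat -> 'M[R]_m)
    (Q_psd : forall k, psdmx (Q k)) (Rk_pd : forall k, pdmx (Rk k))
    (A_bounded : unif_bounded A) (B_bounded : unif_bounded B)
    (Q_bounded : unif_bounded Q) (Rk_bounded : unif_bounded Rk)
    (A_nonsingular : forall k, A k \in unitmx)
    (d : nat) (d_gt0 : (0 < d)%N)
    (controllable : forall k, row_free (ctrlmx A B k d))
    (observable : forall k, row_full (obsmx A Q k d))
    (tA := tildeA A B Q Rk d) (tB := tildeB A B d)
    (tQ := tildeQ A B Q Rk d) (tR := tildeR A B Q Rk d)
    (tQ_inf : 0 < inf (range (fun t => lambda_min (tQ t))))
    (tB_inf : 0 < inf (range (fun t => lambda_min (tB t *m (tB t)^T))))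
    (tA_inf : 0 < inf (range (fun t => lambda_min (tA t *m (tA t)^T))))
    (T : nat) (T_gt0 : (0 < T)%N)
    (X : nat -> 'M[R]_n)
    (X_pd : forall t, pdmx (X (t + T)%N))
    (X_bounded : unif_bounded (fun t => X (t + T)%N))
    (X_riccati : forall t,
       loewner_le
         (riccati (tA (t + T)%N) (tB (t + T)%N) (tQ (t + T)%N) (tR (t + T)%N)
            (X (t + T).+1))
         (X (t + T)%N)) :
  exp_stable (fun t x =>
    tA t *m x + tB t *m rh_policy tA tB tQ tR T X 0 t x).
Proof.
have [q q_gt0 tQ_coercive] :
    exists2 q, 0 < q & forall t x, q * sqn x <= qform (tQ t) x.
  exists (inf (range (fun t => lambda_min (tQ t)))) => // t.
  apply: (qform_ge_lambda_min _ tQ_inf); first exact: tildeQ_sym.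
  by apply: (inf_gt0_lb tQ_inf); exists t.
have A_ebounded := unif_bounded_ebounded A_bounded.
apply: (receding_horizon_exp_stable (K := fun t => zero_input_gain A B Q Rk d t)
  q_gt0 _ tQ_coercive) => // [t|t|||t|].
(* Nonnegativity of [tQ] comes from its coercivity. *)
- split=> [|x]; first exact: tildeQ_sym.
  exact: le_trans (mulr_ge0 (ltW q_gt0) (sqn_ge0 x)) (tQ_coercive t x).
- exact: tildeR_pd.
- have [c c0 Phic] := ebounded_Phi d A_ebounded.
  by exists c => // t i j; rewrite zero_input_dynamics.
- have Xib := ebounded_Xi d A_ebounded (unif_bounded_ebounded Q_bounded).
  have [c c0 XiXic] := eboundedM (ebounded_tr Xib) Xib.
  by exists c => // t i j; rewrite zero_input_stage.
- exact: pdmx_psdmx.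
- exact: unif_bounded_ebounded.
Qed.
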